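(* For every integer $T\ge8$, every $0<\epsilon\le T/1024$, and every $0<\eta<1/2$, there is a family of two stationary backlog inventory instances (IID demand, time-homogeneous costs) such that any estimator, based on $M$ pooled IID demand observations, that estimates $V_1^*(1)$ to additive error $\epsilon$ with probability at least $1-\eta$ on both instances requires $$M\ge\frac{T^3}{360448\,\epsilon^2}(1-2\eta)\log\!\left(\frac{1-\eta}{\eta}\right).$$ In particular, for $\eta\le1/4$, this is $\Omega(T^3\epsilon^{-2}\log(1/\eta))$. The instances have $h_t=p_t=1$ for all $t$ and $D_t\in\{0,1\}$, and the base-stock-zero policy (the policy $x\mapsto\max\{x,0\}$ in every period) is optimal for every instance of the family.
   Context: Backlog inventory model. Horizon $T$; write $u^+=\max\{u,0\}$. Demands $D_1,\ldots,D_T$ are independent with a common law $P$. Holding and shortage coefficients $h_t,p_t>0$ are known. Fixed and per-unit ordering costs, lead time, and terminal salvage value are zero. Starting period $t$ with inventory $x_t$, the retailer chooses a post-order level $y_t\ge\max\{x_t,0\}$ before observing $D_t$, and incurs cost $c_t(y_t,D_t)$ with $c_t(y,d)=h_t(y-d)^++p_t(d-y)^+$; the next state is $x_{t+1}=y_t-D_t$. A feasible policy chooses each action using the information then available, randomization allowed. $V_t^\pi(x)$ is its expected total cost from period $t$ and state $x$, and $V_t^*(x)=\inf_\pi V_t^\pi(x)$. Pooled IID demand observations: fully observed scalars $(D^1,\ldots,D^M)\sim P^{\otimes M}$. An estimator outputs a scalar $\widehat v$ as a (possibly randomized) function of these observations, knowing the costs but not $P$; it estimates $V_1^*(1)$ to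 additive error $\epsilon$ with probability at least $1-\eta$ if $\mathbb P(|\widehat v-V_1^*(1)|>\epsilon)\le\eta$, the probability being over data and randomization. Logarithms are natural. *)

(* Defs.v *)
From HB Require Import structures.
From mathcomp Require Import all_boot all_order all_algebra.
From mathcomp Require Import all_classical all_reals all_analysis measurable_realfun.

Set Implicit Arguments.
Unset Strict Implicit.
Unset Printing Implicit Defensive.

Import Order.TTheory GRing.Theory Num.Theory.

Local Open Scope classical_set_scope.
Local Open Scope ring_scope.

Section inventory.
Context {R : realType}.

(* Periods are the integers t with 1 <= t <= horizon; the values of [hold] and
   [short] outside that range never enter a cost. *)
Record inventory := Inventory {
  horizon : nat;
  hold : nat -> R;
  short : nat -> R;
  demand : probability (measurableTypeR R) R;
  hold_gt0 : forall t, (1 <= t <= horizon)%N -> 0 < hold t;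
  short_gt0 : forall t, (1 <= t <= horizon)%N -> 0 < short t
}.

Definition period_cost (I : inventory) (t : nat) (y d : R) : R :=
  hold I t * Num.max (y - d) 0 + short I t * Num.max (d - y) 0.

(* What has been observed after k completed periods: the inventory x at the
   start of the first of them, then the pairs (post-order level, demand).  The
   past states are functions of this data, since x_{s+1} = y_s - D_s. *)
Definition history (k : nat) : Type :=
  (measurableTypeR R * k.-tuple (measurableTypeR R * measurableTypeR R))%type.

Definition state (k : nat) (h : history k) : R :=
  last h.1 [seq yd.1 - yd.2 | yd <- h.2].

(* [pi s k h] is the law of the post-order level in period s when the
   observations began in period s - k and h is what has been observed since;
   V_t^pi uses it only for s = t + k. *)
Definition policy : Type :=
  nat -> forall k : nat, R.-pker (history k) ~> (measurableTypeR R).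

Definition feasible (pi : policy) : Prop :=
  forall s k (h : history k),
    pi s k h [set y : R | Num.max (state h) 0 <= y] = 1%E.

(* Expectation of f evaluated at the trajectory that extends h by n periods:
   the integral of f against the composition of the kernels of pi with the
   demand law, so that demands are i.i.d. and each one is independent of the
   past and of the current action. *)
Fixpoint expect_trajectory (I : inventory) (pi : policy) (t : nat) (x : R)
    (f : seq (R * R) -> \bar R) (n k : nat) (h : k.-tuple (R * R)) : \bar R :=
  match n with
  | 0 => f h
  | n'.+1 =>
      (\int[pi (t + k)%N k (x, h)]_y \int[demand I]_d
         expect_trajectory I pi t x f n' (rcons_tuple h (y, d)))%E
  end.

Definition total_cost (I : inventory) (t : nat) (tr : seq (R * R)) : R :=
  \sum_(i < size tr)
    period_cost I (t + i)%N (nth (0, 0) tr i).1 (nth (0, 0) tr i).2.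

Definition value (I : inventory) (pi : policy) (t : nat) (x : R) : \bar R :=
  expect_trajectory I pi t x (fun tr => (total_cost I t tr)%:E)
    ((horizon I).+1 - t) [tuple].

Definition opt_value (I : inventory) (t : nat) (x : R) : \bar R :=
  ereal_inf [set value I pi t x | pi in feasible].

Definition optimal (I : inventory) (pi : policy) : Prop :=
  feasible pi /\
  forall t x, (1 <= t <= horizon I)%N -> value I pi t x = opt_value I t x.

Lemma measurable_state (k : nat) :
  measurable_fun [set: history k] (@state k : history k -> measurableTypeR R).
Proof.
case: k => [|k].
  rewrite (_ : @state 0 = fst) //.
  by apply/funext => -[x h]; rewrite /state (tuple0 h).
rewrite (_ : @state k.+1 =
  (fun h => (tnth h.2 ord_max).1 - (tnth h.2 ord_max).2)); last first.
  apply/funext => -[x h]; rewrite /state /= (tnth_nth (0, 0)) /=.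
  rewrite (last_nth 0) size_map size_tuple /=.
  by rewrite (nth_map (0, 0)) ?size_tuple.
have mt : measurable_fun [set: history k.+1] (fun h => tnth h.2 ord_max).
  apply: (@measurableT_comp _ _ _ _ _ _ (fun u => tnth u ord_max)) => //.
  exact: measurable_tnth.
by apply: measurable_funB; apply: (measurableT_comp _ mt).
Qed.

Lemma measurable_base_stock (b : R) (k : nat) :
  measurable_fun [set: history k]
    (fun h : history k => Num.max (state h) b : measurableTypeR R).
Proof. by apply: measurable_maxr => //; exact: measurable_state. Qed.

Definition base_stock (b : R) : policy :=
  fun _ k => kdirac (measurable_base_stock b (k := k)).

End inventory.

Arguments inventory R : clear implicits.
Arguments policy R : clear implicits.

Section estimation.
Context {R : realType}.

Definition cons_pair (M : nat)
    (z : measurableTypeR R * M.-tuple (measurableTypeR R)) :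
    M.+1.-tuple (measurableTypeR R) :=
  [the M.+1.-tuple (measurableTypeR R) of z.1 :: z.2].

Lemma measurable_cons_pair (M : nat) :
  measurable_fun
    [set: measurableTypeR R * M.-tuple (measurableTypeR R)] (@cons_pair M).
Proof. exact: measurable_cons. Qed.

HB.instance Definition _ M :=
  isMeasurableFun.Build _ _ _ _ (@cons_pair M) (@measurable_cons_pair M).

(* The M-fold product of P. *)
Fixpoint iid (P : probability (measurableTypeR R) R) (M : nat) :
    probability (M.-tuple (measurableTypeR R)) R :=
  match M with
  | 0 => dirac [tuple]
  | M'.+1 => distribution (P \x iid P M')%E (@cons_pair M')
  end.

(* A randomized estimator is a probability kernel from data sets to outputs. *)
Definition estimator (M : nat) : Type :=
  R.-pker (M.-tuple (measurableTypeR R)) ~> (measurableTypeR R).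

Definition estimates (M : nat) (e : estimator M) (I : inventory R)
    (t : nat) (x eps eta : R) : Prop :=
  (\int[iid (demand I) M]_D
     e D [set v : R | eps%:E < `|v%:E - opt_value I t x|] <= eta%:E)%E.

End estimation.

Arguments estimator R M : clear implicits.

(* Ring numerals are unary and 360448 is too large for the parser, hence
   360448 = 352 * 1024. *)
Definition sample_bound (R : realType) (T : nat) (eps eta : R) : R :=
  T%:R ^+ 3 / (352 * 1024 * eps ^+ 2) * (1 - 2 * eta) * ln ((1 - eta) / eta).

(* Main.v *)
From HB Require Import structures.
Require Import Defs.
From mathcomp Require Import all_boot all_order all_algebra.
From mathcomp Require Import all_classical all_reals all_analysis.
From mathcomp Require Import measurable_realfun ring lra.

(** Both instances have Bernoulli demand, with success probabilities
    [q1 = 1/(2T)] and [q0 = q1 - 16 eps/T^2].  For [q <= 1/2] the expected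
    one-period cost is nondecreasing in the post-order level [y >= 0], so by
    backward induction base-stock zero is optimal, and from inventory 1
      [V(q) = T q + (1 - 2q) \sum_(t < T) (1 - q)^t].
    Its slope is of order [T^2] for [q] of order [1/T], so that
    [V(q0) - V(q1) > 2 eps].  An accurate estimator therefore tests [q0] against
    [q1], and changing the measure from [q0] to [q1] on M observations costs at
    most [M] times the chi-square divergence, which is of order
    [eps^2 / T^3]. *)

Set Implicit Arguments.
Unset Strict Implicit.
Unset Printing Implicit Defensive.

Import Order.TTheory GRing.Theory Num.Theory.

Local Open Scope classical_set_scope.
Local Open Scope ring_scope.

(** * Integrals of nonnegative functions without measurability *)

Section nonmeasurable_integrands.
Context {R : realType}.
Local Open Scope ereal_scope.

(* The values [expect_trajectory] of an arbitrary policy need not be measurable;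
   the integral of a nonnegative function is a supremum over simple functions
   below it, hence monotone without any measurability. *)
Lemma ge0_le_integral_nomeas d (T : measurableType d)
    (mu : {measure set T -> \bar R}) (f g : T -> \bar R) :
  (forall x, 0 <= f x) -> (forall x, f x <= g x) ->
  \int[mu]_x f x <= \int[mu]_x g x.
Proof.
move=> f0 fg; have g0 x : 0 <= g x by exact: le_trans (fg x).
rewrite !ge0_integralTE//; apply: le_ereal_sup => _ [h hf <-].
by exists h => // x; exact: le_trans (fg x).
Qed.

(** Comparison of [f] with [c] times the indicator of [A]. It serves for the set of admissible
    levels, which has mass one under a feasible policy. *)
Lemma ge_integral_of_probability1 d (T : measurableType d)
    (mu : {measure set T -> \bar R}) (A : set T) (f : T -> \bar R) (c : R) :
  measurable A -> mu A = 1 -> (0 <= c)%R -> (forall x, 0 <= f x) ->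
  (forall x, A x -> c%:E <= f x) -> c%:E <= \int[mu]_x f x.
Proof.
move=> mA muA c0 f0 cf.
rewrite -[leLHS]mule1 -muA -[in leLHS](setIT A) -integral_indic//.
rewrite -ge0_integralZl_EFin//; last first.
  exact/measurable_EFinP/measurable_indic.
apply: ge0_le_integral_nomeas => x; first by rewrite mule_ge0// lee_fin.
rewrite indicE; have [/set_mem Ax|_] := boolP (x \in A); rewrite ?mule1 ?mule0//.
exact: cf.
Qed.

(** [f] is squeezed between two measurable functions that agree with it at [a] and are constant
    elsewhere, equal to 0 or to [+oo]; both integrate to [f a]. *)
Lemma integral_dirac_nomeas (a : measurableTypeR R)
    (f : measurableTypeR R -> \bar R) :
  (forall x, 0 <= f x) -> \int[dirac a]_x f x = f a.
Proof.
move=> f0; pose g c x := if x == a then f a else c.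
have mg c : measurable_fun [set: measurableTypeR R] (g c).
  apply: measurable_fun_ifT => //.
  by apply: measurable_fun_eqr.
have gE c : \int[dirac a]_x g c x = f a.
  by rewrite integral_dirac// diracT mul1e /g eqxx.
apply/eqP; rewrite eq_le; apply/andP; split.
- rewrite -(gE +oo); apply: ge0_le_integral_nomeas => // x.
  by rewrite /g; case: eqP => [->//|_]; rewrite leey.
- rewrite -(gE 0); apply: ge0_le_integral_nomeas => x.
    by rewrite /g; case: ifP.
  by rewrite /g; case: eqP => [->//|_].
Qed.

End nonmeasurable_integrands.

(** * Bernoulli demand as a law on the reals *)

Section binary_demand.
Context {R : realType}.

Definition natb (b : bool) : measurableTypeR R := b%:R.

Lemma measurable_natb : measurable_fun [set: bool] natb.
Proof. by []. Qed.

HB.instance Definition _ :=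
  isMeasurableFun.Build _ _ _ _ natb measurable_natb.

Definition binary_demand (q : R) : probability (measurableTypeR R) R :=
  distribution (bernoulli_prob q) natb.

Lemma binary_demandE (q : R) (A : set (measurableTypeR R)) : 0 <= q <= 1 ->
  binary_demand q A = ((1 - q) * \1_A 0 + q * \1_A 1)%:E.
Proof.
move=> q01; apply: (etrans (bernoulli_probE q01 (natb @^-1` A))).
rewrite !diracE addeC !indicE [in RHS]EFinD.
by rewrite [in RHS]EFinM [in X in (_ = _ + X)%E]EFinM.
Qed.

(** The same squeeze as for the Dirac mass: off the points 0 and 1 the integrand is replaced by the
    constant 0 or [+oo]. *)
Lemma integral_binary_demand (q : R) (f : measurableTypeR R -> \bar R) :
  0 <= q <= 1 -> (forall x, 0 <= f x)%E ->
  (\int[binary_demand q]_d f d = (1 - q)%:E * f 0%R + q%:E * f 1%R)%E.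
Proof.
move=> q01 f0; pose g c (x : measurableTypeR R) : \bar R :=
  if x == 0 then f 0 else if x == 1 then f 1 else c.
have mg c : measurable_fun [set: measurableTypeR R] (g c).
  apply: measurable_fun_ifT => //; first exact: measurable_fun_eqr.
  by apply: measurable_fun_ifT => //; exact: measurable_fun_eqr.
have g0 c : (0 <= c)%E -> forall x, (0 <= g c x)%E.
  by move=> c0 x; rewrite /g; case: ifP => //; case: ifP.
have gE c : (0 <= c)%E -> (\int[binary_demand q]_d g c d =
    (1 - q)%:E * f 0%R + q%:E * f 1%R)%E.
  move=> c0; rewrite ge0_integral_distribution//=; last exact: g0.
  rewrite integral_bernoulli_prob//=; last by move=> x; exact: g0.
  by rewrite addeC /g /natb/= eqxx oner_eq0 eqxx.
apply/eqP; rewrite eq_le; apply/andP; split.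
- rewrite -(gE +oo%E)//; apply: ge0_le_integral_nomeas => // x.
  rewrite /g; case: eqP => [->//|_]; case: eqP => [->//|_]; exact: leey.
- rewrite -(gE 0%E)//; apply: ge0_le_integral_nomeas => x; first exact: g0.
  by rewrite /g; case: eqP => [->//|_]; case: eqP => [->//|_].
Qed.

End binary_demand.

(** * Backward induction and optimality of base-stock zero *)

Section unit_cost_inventory.
Context {R : realType}.
Implicit Types (T : nat) (q : R) (pi : policy R).

Definition unit_inventory T q : inventory R :=
  @Inventory R T (fun=> 1) (fun=> 1) (binary_demand q)
    (fun _ _ => ltr01) (fun _ _ => ltr01).

Lemma period_cost_unit T q t (y d : R) :
  period_cost (unit_inventory T q) t y d = `|y - d|.
Proof.
rewrite /period_cost /= !mul1r -(opprB y d).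
have [h|h] : 0 <= y - d \/ y - d <= 0 by apply/orP; exact: le_total.
  by rewrite max_l ?max_r ?oppr_le0 ?ger0_norm ?addr0.
by rewrite max_r ?max_l ?oppr_ge0 ?ler0_norm ?add0r.
Qed.

(** Cost-to-go of the base-stock-zero policy with [n] periods left. Costs and demand are stationary,
    so the calendar period does not enter. *)
Fixpoint base_stock_cost q (n : nat) (x : R) : R :=
  if n isn't n'.+1 then 0 else
  let y := Num.max x 0 in
  (1 - q) * (`|y - 0| + base_stock_cost q n' (y - 0)) +
  q * (`|y - 1| + base_stock_cost q n' (y - 1)).

Lemma base_stock_cost_ge0 q n x : 0 <= q <= 1 -> 0 <= base_stock_cost q n x.
Proof.
move=> /andP[q0 q1]; elim: n x => [//|n IH] x /=.
by apply: addr_ge0; apply: mulr_ge0; rewrite ?subr_ge0 ?addr_ge0.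
Qed.

(** Raising the level from [y] to [z] adds [z - y] to the cost when the demand is 0 and saves at
    most [z - y] when it is 1. The first outcome is at least as likely because [q <= 1 / 2], and the
    continuation [f] is monotone. *)
Lemma step_cost_le q (f : R -> R) (y z : R) : 0 <= q <= 1 / 2 ->
  {homo f : u v / u <= v} -> 0 <= y -> y <= z ->
  (1 - q) * (`|y - 0| + f (y - 0)) + q * (`|y - 1| + f (y - 1)) <=
  (1 - q) * (`|z - 0| + f (z - 0)) + q * (`|z - 1| + f (z - 1)).
Proof.
move=> /andP[q0 q1] f_mono y0 yz; rewrite !subr0.
have fyz := f_mono _ _ yz.
have fyz1 : f (y - 1) <= f (z - 1) by apply: f_mono; lra.
have nyz : `|y - 1| <= `|z - 1| + (z - y).
  rewrite [leRHS]addrC (le_trans (ler_distD z _ _))// lerD2r distrC.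
  by rewrite (ger0_norm (x := z - y)) ?subr_ge0.
rewrite (ger0_norm y0) (ger0_norm (le_trans y0 yz)).
have h1 : q * (`|y - 1| + f (y - 1)) <= q * (`|z - 1| + (z - y) + f (z - 1)).
  by apply: ler_wpM2l => //; exact: lerD.
have h2 : (1 - q) * f y <= (1 - q) * f z by apply: ler_wpM2l => //; lra.
have h3 : q * (z - y) <= (1 - q) * (z - y) by apply: ler_wpM2r; lra.
by rewrite !mulrDr in h1 *; lra.
Qed.

Lemma base_stock_cost_le q n : 0 <= q <= 1 / 2 ->
  {homo base_stock_cost q n : x y / x <= y}.
Proof.
move=> qh; elim: n => [//|n IH] x y xy /=; apply: (step_cost_le qh IH).
  by rewrite le_max lexx orbT.
by rewrite ge_max !le_max xy lexx orbT.
Qed.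

Lemma total_cost_ge0 T q t (tr : seq (R * R)) :
  0 <= total_cost (unit_inventory T q) t tr.
Proof. by apply: sumr_ge0 => i _; rewrite period_cost_unit. Qed.

Lemma total_cost_rcons T q t (tr : seq (R * R)) y d :
  total_cost (unit_inventory T q) t (rcons tr (y, d)) =
  total_cost (unit_inventory T q) t tr + `|y - d|.
Proof.
rewrite /total_cost size_rcons big_ord_recr /= period_cost_unit.
rewrite nth_rcons ltnn eqxx /=; congr (_ + _).
by apply: eq_bigr => i _; rewrite nth_rcons ltn_ord.
Qed.

Lemma state_rcons k (x : R) (h : k.-tuple (R * R)) y d :
  state ((x, rcons_tuple h (y, d)) : history k.+1) = y - d.
Proof. by rewrite /state /= map_rcons last_rcons. Qed.

Lemma expect_trajectory_ge0 T q pi t x n k (h : k.-tuple (R * R)) :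
  (0 <= expect_trajectory (unit_inventory T q) pi t x
    (fun tr => (total_cost (unit_inventory T q) t tr)%:E) n h)%E.
Proof.
elim: n k h => [|n IH] k h /=; first by rewrite lee_fin total_cost_ge0.
by apply: integral_ge0 => y _; apply: integral_ge0 => d _; exact: IH.
Qed.

(** Induction on the periods left, for an arbitrary history: the kernel is carried by the levels
    above [Num.max s 0], and by [step_cost_le] the lowest of them is the cheapest. *)
Lemma expect_trajectory_ge T q pi t x n k (h : k.-tuple (R * R)) :
  0 <= q <= 1 / 2 -> feasible pi ->
  ((total_cost (unit_inventory T q) t h +
    base_stock_cost q n (state ((x, h) : history k)))%:E <=
   expect_trajectory (unit_inventory T q) pi t x
    (fun tr => (total_cost (unit_inventory T q) t tr)%:E) n h)%E.
Proof.
move=> qh pi_feasible.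
have q01 : 0 <= q <= 1 by case/andP: qh => q0 q2; apply/andP; split; lra.
elim: n k h => [|n IH] k h; first by rewrite addr0.
set s := state _.
apply: (ge_integral_of_probability1
  (A := [set y : measurableTypeR R | Num.max s 0 <= y])).
- rewrite (_ : [set _ | _] = `[Num.max s 0, +oo[%classic).
    exact: measurable_itv.
  by apply/seteqP; split => y /=; rewrite in_itv/= andbT.
- exact: pi_feasible.
- by rewrite addr_ge0 ?total_cost_ge0 ?base_stock_cost_ge0.
- by move=> y; apply: integral_ge0 => d _; exact: expect_trajectory_ge0.
move=> y /= sy; rewrite integral_binary_demand//; last first.
  by move=> d; exact: expect_trajectory_ge0.
have := step_cost_le (y := Num.max s 0) (z := y) qh (@base_stock_cost_le q n qh).
rewrite le_max lexx orbT => /(_ isT sy) step.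
set c := total_cost _ _ _.
apply: (@le_trans _ _ ((1 - q)%:E *
    (c + `|y - 0| + base_stock_cost q n (y - 0))%:E + q%:E *
    (c + `|y - 1| + base_stock_cost q n (y - 1))%:E)%E).
  by rewrite -!EFinM -EFinD lee_fin; move: step; rewrite !mulrDr; lra.
by case/andP: q01 => q0 q1; apply: leeD; apply: lee_wpmul2l;
  rewrite ?lee_fin ?subr_ge0// -total_cost_rcons -(state_rcons x h); exact: IH.
Qed.

Lemma expect_trajectory_base_stock T q t x n k (h : k.-tuple (R * R)) :
  0 <= q <= 1 ->
  expect_trajectory (unit_inventory T q) (base_stock 0) t x
    (fun tr => (total_cost (unit_inventory T q) t tr)%:E) n h =
  (total_cost (unit_inventory T q) t h +
    base_stock_cost q n (state ((x, h) : history k)))%:E.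
Proof.
move=> q01; elim: n k h => [|n IH] k h; first by rewrite addr0.
set s := state _; set c := total_cost _ _ _.
transitivity (\int[dirac (Num.max s 0%R : measurableTypeR R)]_y
  \int[binary_demand q]_d (c + `|y - d| + base_stock_cost q n (y - d))%:E)%E.
  rewrite /=; apply: eq_integral => y _; apply: eq_integral => d _.
  by rewrite IH state_rcons total_cost_rcons.
have ge0 y d : (0 <= (c + `|y - d| + base_stock_cost q n (y - d))%:E)%E.
  by rewrite lee_fin !addr_ge0 ?total_cost_ge0 ?base_stock_cost_ge0.
rewrite integral_dirac_nomeas => [|y]; last exact: integral_ge0.
rewrite integral_binary_demand//.
by rewrite -!EFinM -EFinD; congr _%:E; rewrite /=; ring.
Qed.

Lemma feasible_base_stock (b : R) : 0 <= b -> feasible (base_stock b).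
Proof.
move=> b0 s k h; rewrite /base_stock /= /kdirac /= diracE mem_set//=.
by rewrite ge_max !le_max lexx b0 orbT.
Qed.

Lemma value_base_stock0 T q t x : 0 <= q <= 1 ->
  value (unit_inventory T q) (base_stock 0) t x =
  (base_stock_cost q (T.+1 - t) x)%:E.
Proof.
move=> q01; rewrite /value expect_trajectory_base_stock// /state/=; congr _%:E.
by rewrite /total_cost big_ord0 add0r.
Qed.

Lemma opt_value_unit T q t x : 0 <= q <= 1 / 2 ->
  opt_value (unit_inventory T q) t x = (base_stock_cost q (T.+1 - t) x)%:E.
Proof.
move=> qh; apply/eqP; rewrite eq_le; apply/andP; split.
  rewrite -(@value_base_stock0 T); last first.
    by case/andP: qh => q0 q2; apply/andP; split; lra.
  apply: ereal_inf_lbound; exists (base_stock 0) => //.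
  exact: feasible_base_stock.
apply: le_ereal_inf_tmp => _ [pi pi_feasible <-].
have := @expect_trajectory_ge T q pi t x (T.+1 - t) 0 [tuple] qh pi_feasible.
by rewrite /total_cost big_ord0 add0r.
Qed.

Lemma optimal_base_stock0 T q : 0 <= q <= 1 / 2 ->
  optimal (unit_inventory T q) (base_stock 0).
Proof.
move=> qh; split=> [|t x _]; first exact: feasible_base_stock.
rewrite opt_value_unit// value_base_stock0//.
by case/andP: qh => q0 q2; apply/andP; split; lra.
Qed.

(** Ordering up to 0 makes the cost of each period equal to its demand, of mean [q], and the state
    stays nonpositive. *)
Lemma base_stock_cost_le0 q n (x : R) : x <= 0 -> base_stock_cost q n x = q *+ n.
Proof.
elim: n x => [//|n IH] x x0 /=; rewrite (max_r x0) subr0 sub0r !IH ?lerN10//.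
by rewrite normrN1 normr0 mulrS; ring.
Qed.

(** The initial unit is still in stock after [t] periods with probability [(1 - q) ^+ t]. A period
    begun with it costs [1 - q] on average, one begun without it costs [q]: the excess is
    [1 - 2 * q]. *)
Lemma base_stock_cost1 q n :
  base_stock_cost q n 1 = n%:R * q + (1 - 2 * q) * \sum_(t < n) (1 - q) ^+ t.
Proof.
elim: n => [|n IH] /=; first by rewrite big_ord0 mul0r mulr0 addr0.
rewrite (max_l ler01) subr0 subrr normr1 normr0 IH base_stock_cost_le0//.
rewrite big_ord_recl /=; under [in RHS]eq_bigr do rewrite exprS.
by rewrite -mulr_sumr -mulr_natr -natr1 expr0; ring.
Qed.

End unit_cost_inventory.

(** * Separation of the two optimal values *)

Section value_gap.
Context {R : realType}.

Lemma sum_ord_natr (n : nat) : \sum_(t < n) t%:R = n%:R * (n%:R - 1) / 2 :> R.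
Proof.
elim: n => [|n IH]; first by rewrite big_ord0 mul0r mul0r.
by rewrite big_ord_recr/= IH -natr1; field.
Qed.

Lemma bernoulli_inequality (q : R) n :
  0 <= q <= 1 -> 1 - n%:R * q <= (1 - q) ^+ n.
Proof.
move=> /andP[q0 q1]; elim: n => [|n IH]; first by rewrite mul0r subr0 expr0.
have := ler_wpM2l (_ : 0 <= 1 - q) IH; rewrite subr_ge0 => /(_ q1).
rewrite exprS -natr1; apply: le_trans.
have : 0 <= n%:R * q * q by rewrite !mulr_ge0.
by lra.
Qed.

(** The tangent bound with slope [n * r ^ (n - 1)], weakened by one factor [r <= 1] so that no
    exponent [n - 1] occurs. *)
Lemma exprn_gap (r d : R) n : 0 <= r <= 1 -> 0 <= d ->
  n%:R * d * r ^+ n <= (r + d) ^+ n - r ^+ n.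
Proof.
move=> /andP[r0 r1] d0; elim: n => [|n IH]; first by rewrite mul0r mul0r subrr.
have rn0 : 0 <= r ^+ n by exact: exprn_ge0.
have h1 := ler_wpM2l (addr_ge0 r0 d0) IH.
have h2 : 0 <= n%:R * d * r ^+ n * d by rewrite !mulr_ge0.
have h3 : 0 <= d * r ^+ n * (1 - r) by rewrite !mulr_ge0// subr_ge0.
by rewrite !exprS -natr1; lra.
Qed.

(** The constant is [(7 / 16) ^ 2]. One factor is [7 / 8 * 1 / 2], from [1 - 2 * q >= 7 / 8] and
    [(1 - q) ^+ t >= 1 / 2]; the other comes from [T * (T - 1) / 2 >= 7 / 16 * T ^ 2]. *)
Lemma base_stock_cost1_gap (T : nat) (q d : R) :
  (8 <= T)%N -> 0 <= d -> d <= q -> q * T%:R = 1 / 2 ->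
  T%:R ^+ 2 * d * (49 / 256) <=
  base_stock_cost (q - d) T 1 - base_stock_cost q T 1.
Proof.
move=> T8 d0 dq qT.
have T8R : 8 <= T%:R :> R by rewrite ler_nat.
have q0 : 0 <= q by exact: le_trans dq.
have q16 : q <= 1 / 16.
  by have : q * 8 <= q * T%:R by [exact: ler_wpM2l]; lra.
rewrite !base_stock_cost1.
(* The difference of the two products is [(1 - 2 * q) * (r0 - r1) + 2 * d * r0]. As [r0 >= 1 / 2],
   its last term pays for the [- d], which is the loss per period in the linear part of the
   value. *)
have termwise (t : 'I_T) : 7 / 16 * d * t%:R <=
    (1 - 2 * (q - d)) * (1 - (q - d)) ^+ t - (1 - 2 * q) * (1 - q) ^+ t - d.
  have half : 1 / 2 <= (1 - q) ^+ t.
    apply: le_trans (bernoulli_inequality t _); last by lra.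
    have : t%:R * q <= T%:R * q by apply: ler_wpM2r => //; rewrite ler_nat ltnW.
    by lra.
  have gap := @exprn_gap (1 - q) d t.
  have {}gap : t%:R * d * (1 - q) ^+ t <= (1 - (q - d)) ^+ t - (1 - q) ^+ t.
    rewrite opprB (_ : 1 + (d - q) = 1 - q + d); last by ring.
    by apply: gap => //; lra.
  have t0 : 0 <= t%:R * d by rewrite mulr_ge0.
  have h1 := ler_wpM2l t0 half.
  set r0 := (1 - (q - d)) ^+ t in gap *; set r1 := (1 - q) ^+ t in half gap h1 *.
  have h2 : (7 / 8) * (t%:R * d / 2) <= (1 - 2 * q) * (r0 - r1).
    by apply: ler_pM; lra.
  have h3 : d * (1 / 2) <= d * r0 by apply: ler_wpM2l => //; lra.
  by lra.
set S0 := \sum_(t < T) (1 - (q - d)) ^+ t; set S1 := \sum_(t < T) _.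
have h : 7 / 16 * d * (\sum_(t < T) t%:R) <=
    (1 - 2 * (q - d)) * S0 - (1 - 2 * q) * S1 - T%:R * d.
  have -> : T%:R * d = \sum_(t < T) d by rewrite sumr_const card_ord mulr_natl.
  rewrite !mulr_sumr -!sumrB.
  by apply: ler_sum => t _; exact: termwise.
rewrite sum_ord_natr in h.
have h4 : 7 / 8 * T%:R ^+ 2 * d <= T%:R * (T%:R - 1) * d.
  apply: ler_wpM2r => //; rewrite expr2.
  have : T%:R * (7 / 8 * T%:R) <= T%:R * (T%:R - 1 : R) by apply: ler_wpM2l; lra.
  by lra.
by lra.
Qed.

End value_gap.

(** * Change of measure between products of Bernoulli laws *)

Lemma expR_jensen {R : realType} (p x y : R) : 0 <= p <= 1 ->
  expR ((1 - p) * x + p * y) <= (1 - p) * expR x + p * expR y.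
Proof.
move=> /andP[p0 p1]; have := convex_expR (Itv01 p0 p1) y x.
by rewrite !convRE /= /unstable.onem ![p * _ + _]addrC.
Qed.

Section change_of_measure.
Context {R : realType}.
Implicit Types (q : R) (M : nat).

(** Expectation over [M] i.i.d. Bernoulli observations as a finite recursion, so that the
    inequalities below involve no measurability; [integral_iid] links it to the integral. *)
Fixpoint expect q M : (M.-tuple (measurableTypeR R) -> R) -> R :=
  match M with
  | 0 => fun f => f [tuple]
  | M'.+1 => fun f =>
      (1 - q) * expect q (fun D : M'.-tuple _ => f (cons_pair (0, D))) +
      q * expect q (fun D : M'.-tuple _ => f (cons_pair (1, D)))
  end.

Lemma le_expect q M (f g : M.-tuple (measurableTypeR R) -> R) : 0 <= q <= 1 ->
  (forall D, f D <= g D) -> expect q f <= expect q g.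
Proof.
move=> /andP[q0 q1]; elim: M f g => [|M IH] f g fg /=; first exact: fg.
by apply: lerD; apply: ler_wpM2l; rewrite ?subr_ge0//; exact: IH.
Qed.

Lemma expect_affine q M (a b : R) (f : M.-tuple (measurableTypeR R) -> R) :
  expect q (fun D => a * f D + b) = a * expect q f + b.
Proof. by elim: M f => [//|M IH] f /=; rewrite !IH; ring. Qed.

Lemma integral_iid q M (f : M.-tuple (measurableTypeR R) -> R) :
  0 <= q <= 1 -> (forall D, 0 <= f D) -> measurable_fun setT f ->
  (\int[iid (binary_demand q) M]_D (f D)%:E = (expect q f)%:E)%E.
Proof.
move=> q01; elim: M f => [|M IH] f f0 mf /=.
  by rewrite integral_dirac ?diracT ?mul1e//; exact/measurable_EFinP.
have mEf : measurable_fun setT (EFin \o f) by exact/measurable_EFinP.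
transitivity (\int[binary_demand q \x iid (binary_demand q) M]_z
    (f (cons_pair z))%:E)%E.
  by rewrite ge0_integral_distribution// => D; rewrite lee_fin.
rewrite fubini_tonelli1; last 2 first.
- by apply: (measurableT_comp mEf); exact: measurable_cons_pair.
- by move=> z; rewrite lee_fin.
rewrite integral_binary_demand//; last first.
  by move=> d; apply: integral_ge0 => D _; rewrite lee_fin.
rewrite /fubini_F /= !IH//.
- apply: (measurableT_comp mf).
  apply: (measurableT_comp (@measurable_cons_pair R M)).
  exact: pair1_measurable.
- apply: (measurableT_comp mf).
  apply: (measurableT_comp (@measurable_cons_pair R M)).
  exact: pair1_measurable.
Qed.

(** The chi-square divergence of Bernoulli [q0] from Bernoulli [q1]. *)
Definition chi2 (q0 q1 : R) : R := (1 - q0) ^+ 2 / (1 - q1) + q0 ^+ 2 / q1 - 1.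

(** The right side is rewritten as a mean under [q0] by inserting the likelihood ratio. Jensen takes
    the exponential outside, and [ln u >= 1 - u^-1] bounds the mean log-ratio below by
    [- chi2 q0 q1]. *)
Lemma change_of_measure1 (q0 q1 a b : R) : 0 < q0 < 1 -> 0 < q1 < 1 ->
  expR ((1 - q0) * a + q0 * b - chi2 q0 q1) <=
  (1 - q1) * expR a + q1 * expR b.
Proof.
move=> /andP[q00 q01] /andP[q10 q11].
have ln_ge (u : R) : 0 < u -> 1 - u^-1 <= ln u.
  move=> u0; have := @le_ln1Dx R (u^-1 - 1).
  by rewrite subrKC lnV// ltrBrDl subrr invr_gt0 => /(_ u0); lra.
have u0 : 0 < (1 - q1) / (1 - q0) by rewrite divr_gt0; lra.
have v0 : 0 < q1 / q0 by rewrite divr_gt0.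
have := @expR_jensen R q0 (a + ln ((1 - q1) / (1 - q0))) (b + ln (q1 / q0)) _.
rewrite (expRD a) (expRD b) !lnK// => /(_ ltac:(apply/andP; split; lra)) J.
have -> : (1 - q1) * expR a + q1 * expR b = (1 - q0) *
    (expR a * ((1 - q1) / (1 - q0))) + q0 * (expR b * (q1 / q0)).
  by field; rewrite ?gt_eqF//; lra.
apply: le_trans J; rewrite ler_expR.
have := ler_wpM2l (_ : 0 <= 1 - q0) (ln_ge _ u0) => /(_ ltac:(lra)) h1.
have := ler_wpM2l (ltW q00) (ln_ge _ v0) => h2.
suff : - chi2 q0 q1 = (1 - q0) * (1 - ((1 - q1) / (1 - q0))^-1) +
    q0 * (1 - (q1 / q0)^-1) by lra.
by rewrite /chi2; field; rewrite ?gt_eqF//; lra.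
Qed.

(* The Donsker-Varadhan inequality for M-fold products, with the relative
   entropy replaced by its upper bound chi2. *)
Lemma change_of_measure (q0 q1 : R) M (g : M.-tuple (measurableTypeR R) -> R) :
  0 < q0 < 1 -> 0 < q1 < 1 ->
  expR (expect q0 g - M%:R * chi2 q0 q1) <= expect q1 (fun D => expR (g D)).
Proof.
move=> q0p q1p; elim: M g => [|M IH] g /=; first by rewrite mul0r subr0.
set a := expect q0 _; set b := expect q0 _.
have -> : (1 - q0) * a + q0 * b - M.+1%:R * chi2 q0 q1 =
    (1 - q0) * (a - M%:R * chi2 q0 q1) + q0 * (b - M%:R * chi2 q0 q1) - chi2 q0 q1.
  by rewrite -natr1; ring.
apply: le_trans (change_of_measure1 _ _ q0p q1p) _.
by apply: lerD; apply: ler_wpM2l; rewrite ?IH//; lra.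
Qed.

(* Change of measure for g = (1 - 2 f) ln((1 - eta)/eta), whose exponential is
   bounded, by convexity, by the chord in f. *)
Lemma testing_bound (q0 q1 eta : R) M (f g : M.-tuple (measurableTypeR R) -> R) :
  0 < q0 < 1 -> 0 < q1 < 1 -> 0 < eta -> eta < 1 / 2 ->
  (forall D, 0 <= f D <= 1) -> (forall D, 1 <= f D + g D) ->
  expect q0 f <= eta -> expect q1 g <= eta ->
  (1 - 2 * eta) * ln ((1 - eta) / eta) <= M%:R * chi2 q0 q1.
Proof.
move=> q0p q1p eta0 eta2 f01 fg Ef Eg.
set L := ln _.
have oe0 : 0 < 1 - eta by lra.
have eL : expR L = (1 - eta) / eta by rewrite lnK// posrE divr_gt0.
have eNL : expR (- L) = eta / (1 - eta) by rewrite expRN eL invf_div.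
have L0 : 0 <= L by rewrite ln_ge0// ler_pdivlMr//; lra.
have := @change_of_measure q0 q1 M (fun D => - (2 * L) * f D + L) q0p q1p.
rewrite expect_affine.
have chord D : expR (- (2 * L) * f D + L) <= expR (- L) +
    (expR L - expR (- L)) * (1 - f D).
  have /andP[f0 f1] := f01 D.
  have := @expR_jensen R (1 - f D) (- L) L _.
  rewrite (_ : (1 - _) * - L + _ = - (2 * L) * f D + L); last by ring.
  move=> /(_ ltac:(apply/andP; split; lra)) /le_trans; apply.
  by rewrite le_eqVlt; apply/orP; left; apply/eqP; ring.
have bound : expect q1 (fun D => expR (- (2 * L) * f D + L)) <= 1.
  apply: (@le_trans _ _
    (expect q1 (fun D => (expR L - expR (- L)) * g D + expR (- L)))).
    apply: le_expect => [|D]; first by lra.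
    apply: le_trans (chord D) _; rewrite addrC lerD2r; apply: ler_wpM2l.
      by rewrite subr_ge0 ler_expR; lra.
    by have := fg D; lra.
  rewrite expect_affine.
  apply: (@le_trans _ _ ((expR L - expR (- L)) * eta + expR (- L))).
    by rewrite lerD2r; apply: ler_wpM2l; rewrite // subr_ge0 ler_expR; lra.
  (* The choice of [L] makes the chord, evaluated at error probability [eta], exactly 1. *)
  rewrite eL eNL le_eqVlt; apply/orP; left; apply/eqP.
  by field; rewrite ?gt_eqF//.
move=> /le_trans /(_ bound); rewrite -[leRHS]expR0 ler_expR => h.
have h2 : L * expect q0 f <= L * eta by exact: ler_wpM2l.
lra.
Qed.

End change_of_measure.

(** * From estimation to testing, and the numerical constants *)

Section two_instances.
Context {R : realType}.

Lemma measurable_far (eps w : R) :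
  measurable ([set v | eps < `|v - w|] : set (measurableTypeR R)).
Proof.
have mf : measurable_fun setT (fun v : measurableTypeR R => `|v - w|).
  by apply: measurableT_comp => //; exact: measurable_funB.
have := mf measurableT _ (measurable_itv `]eps, +oo[); rewrite setTI.
by congr measurable; apply/seteqP; split => v /=; rewrite in_itv/= andbT.
Qed.

Lemma prob_kernel_le1 d d' (X : measurableType d) (Y : measurableType d')
    (k : R.-pker X ~> Y) x (A : set Y) : measurable A -> (k x A <= 1)%E.
Proof.
by move=> mA; rewrite -(prob_kernel (s := k) x); apply: le_measure; rewrite ?inE.
Qed.

Lemma prob_kernel_fin_num d d' (X : measurableType d) (Y : measurableType d')
    (k : R.-pker X ~> Y) x (A : set Y) : measurable A -> k x A \is a fin_num.
Proof.
by move=> mA; rewrite ge0_fin_numE// (le_lt_trans (prob_kernel_le1 k x mA))// ltry.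
Qed.

Lemma estimatesE (T M : nat) (q eps eta w : R) (e : estimator R M) :
  0 <= q <= 1 / 2 -> base_stock_cost q T 1 = w ->
  estimates e (unit_inventory T q) 1 1 eps eta ->
  expect q (fun D => fine (e D [set v : R | eps < `|v - w|])) <= eta.
Proof.
move=> qh <-; rewrite /estimates opt_value_unit// subSS subn0.
set w' := base_stock_cost _ _ _; set A := [set v : R | eps < `|v - w'|].
have mA : measurable (A : set (measurableTypeR R)).
  exact: measurable_far.
have eA D : e D A = (fine (e D A))%:E by rewrite fineK// prob_kernel_fin_num.
under eq_integral do rewrite eA.
rewrite integral_iid ?lee_fin//.
- by case/andP: qh => q0 q2; apply/andP; split; lra.
- by apply: measurableT_comp => //; exact: measurable_kernel.
Qed.

(** No output is within [eps] of both values, so the two failure events cover the line and their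
    conditional probabilities given the data sum to at least 1. These are the [f] and [g] of
    [testing_bound]. *)
Lemma separated_values_sample_bound (T M : nat) (q0 q1 eps eta : R)
    (e : estimator R M) :
  0 < q0 <= 1 / 2 -> 0 < q1 <= 1 / 2 -> 0 < eta -> eta < 1 / 2 ->
  2 * eps < base_stock_cost q0 T 1 - base_stock_cost q1 T 1 ->
  estimates e (unit_inventory T q0) 1 1 eps eta ->
  estimates e (unit_inventory T q1) 1 1 eps eta ->
  (1 - 2 * eta) * ln ((1 - eta) / eta) <= M%:R * chi2 q0 q1.
Proof.
move=> /andP[q00 q0h] /andP[q10 q1h] eta0 eta2.
set w0 := base_stock_cost q0 T 1; set w1 := base_stock_cost q1 T 1 => sep.
have mA := @measurable_far eps.
have fin D (w : R) : (e D [set v | (eps < `|v - w|)%R] \is a fin_num)%E.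
  exact: prob_kernel_fin_num.
have h (q : R) : 0 < q -> q <= 1 / 2 -> 0 <= q <= 1 / 2.
  by move=> *; apply/andP; split; lra.
move=> /(@estimatesE T M q0 eps eta w0 e (h _ q00 q0h) erefl) E0.
move=> /(@estimatesE T M q1 eps eta w1 e (h _ q10 q1h) erefl) E1.
apply: (testing_bound _ _ eta0 eta2 _ _ E0 E1); rewrite ?q00 ?q10 /=; try lra.
- move=> D; rewrite fine_ge0//= -[leRHS]/(fine 1%E) fine_le ?fin//.
  exact: prob_kernel_le1.
- move=> D; rewrite -fineD// -[leLHS]/(fine 1%E) fine_le// ?fin_numD ?fin//.
  rewrite -(prob_kernel (s := e) D).
  apply: le_trans (measureU2 _ _ _) => //; apply: le_measure; rewrite ?inE//.
    by apply: measurableU.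
  move=> v _ /=; apply/orP; rewrite !ltNge -negb_and; apply/negP => /andP[].
  rewrite !ler_norml => /andP[? ?] /andP[? ?]; lra.
Qed.

Lemma chi2_shift (q d : R) : 0 < q < 1 ->
  chi2 (q - d) q = d ^+ 2 / (q * (1 - q)).
Proof.
move=> /andP[q0 q1]; rewrite /chi2; field.
by rewrite ?gt_eqF//; lra.
Qed.

(** With these parameters the divergence is [512 * eps ^ 2 / (T ^ 3 * (1 - q))] for
    [q = 1 / (2 * T) <= 1 / 16], and [512 <= 1024 * (15 / 16)]. *)
Lemma sample_bound_le (T : nat) (eps eta m : R) : (8 <= T)%N -> 0 < eps ->
  (1 - 2 * eta) * ln ((1 - eta) / eta) <=
    m * chi2 (1 / (2 * T%:R) - 16 * eps / T%:R ^+ 2) (1 / (2 * T%:R)) ->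
  0 <= m ->
  sample_bound T eps eta <= m.
Proof.
move=> T8 eps0 h m0; rewrite /sample_bound -mulrA.
have T8R : 8 <= T%:R :> R by rewrite ler_nat.
set x : R := T%:R in T8R h *.
have x0 : 0 < x by lra.
have q1 : 1 / (2 * x) <= 1 / 16.
  by rewrite ler_pdivrMr ?mulr_gt0//; lra.
have q0 : 0 < 1 / (2 * x) by rewrite divr_gt0 ?mulr_gt0.
(* Numerals are unary: the constant is abstracted before [//] can unfold it. *)
have : 1024 <= 352 * 1024 :> R by lra.
move: (352 * 1024 : R) => C C1024.
have C0 : 0 < C by lra.
have c0 : 0 <= x ^+ 3 / (C * eps ^+ 2).
  by rewrite divr_ge0 ?mulr_ge0 ?exprn_ge0 ?(ltW C0) ?(ltW x0) ?(ltW eps0).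
apply: le_trans (ler_wpM2l c0 h) _.
rewrite chi2_shift; last by apply/andP; split; lra.
have y0 : 0 < 1 - 1 / (2 * x) by lra.
have -> : x ^+ 3 / (C * eps ^+ 2) * (m * ((16 * eps / x ^+ 2) ^+ 2 /
    (1 / (2 * x) * (1 - 1 / (2 * x))))) = m * (512 / (C * (1 - 1 / (2 * x)))).
  by move: y0; set y := 1 - _ => y0; field; rewrite ?gt_eqF.
apply: ler_piMr; first exact: m0.
rewrite ler_pdivrMr; last exact: mulr_gt0.
have : 1024 * (15 / 16) <= C * (1 - 1 / (2 * x)) by apply: ler_pM; lra.
by lra.
Qed.

(** For [eta <= 1 / 4], [eta <= (1 - eta) ^ 2] gives [1 / eta <= ((1 - eta) / eta) ^ 2], which costs
    a factor 2 in the logarithm; [1 - 2 * eta >= 1 / 2] costs another. *)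
Lemma sample_bound_ge (T : nat) (eps eta : R) : 0 < eta -> eta <= 1 / 4 ->
  (4 * (352 * 1024))^-1 * (T%:R ^+ 3 * eps ^- 2 * ln (1 / eta)) <=
  sample_bound T eps eta.
Proof.
move=> eta0 eta4; have oe0 : 0 < 1 - eta by lra.
have l0 : 0 <= ln (1 / eta) by rewrite ln_ge0// ler_pdivlMr//; lra.
have lle : ln (1 / eta) <= 2 * ln ((1 - eta) / eta).
  rewrite mulr_natl -lnXn ?divr_gt0// ler_ln ?posrE ?exprn_gt0 ?divr_gt0//.
  rewrite expr_div_n ler_pdivlMr ?exprn_gt0// expr2 mul1r mulKf ?gt_eqF//.
  have : (3 / 4) * (3 / 4) <= (1 - eta) * (1 - eta) by apply: ler_pM; lra.
  by rewrite expr2; lra.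
have c0 : 0 <= T%:R ^+ 3 * eps ^- 2 :> R.
  by rewrite mulr_ge0 ?exprn_ge0// invr_ge0 exprn_even_ge0.
have key : 4^-1 * ln (1 / eta) <= (1 - 2 * eta) * ln ((1 - eta) / eta).
  have : 1 / 2 * (ln (1 / eta) / 2) <= (1 - 2 * eta) * ln ((1 - eta) / eta).
    by apply: ler_pM; lra.
  by lra.
rewrite /sample_bound; have : 0 < 352 * 1024 :> R by lra.
move: (352 * 1024 : R) => C C0.
have cC0 : 0 <= C^-1 * (T%:R ^+ 3 * eps ^- 2) by rewrite mulr_ge0// invr_ge0 ltW.
have := ler_wpM2l cC0 key; rewrite !invfM.
by move=> h; apply: le_trans (le_trans h _); rewrite le_eqVlt; apply/orP; left;
  apply/eqP; ring.
Qed.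

End two_instances.

(** * The two-instance lower bound *)

Theorem theorem3 (R : realType) :
  (forall (T : nat) (eps eta : R),
     (8 <= T)%N -> 0 < eps -> eps <= T%:R / 1024 -> 0 < eta -> eta < 1 / 2 ->
     exists I : bool -> inventory R,
       [/\ demand (I false) <> demand (I true),
           forall b, [/\ horizon (I b) = T,
                         forall t, (1 <= t <= T)%N ->
                           hold (I b) t = 1 /\ short (I b) t = 1,
                         demand (I b) [set 0; 1] = 1%E
                       & optimal (I b) (base_stock 0)]
         & forall (M : nat) (e : estimator R M),
             (forall b, estimates e (I b) 1 1 eps eta) ->
             sample_bound T eps eta <= M%:R]) /\
  (exists2 c : R, 0 < c &
     forall (T : nat) (eps eta : R),
       (8 <= T)%N -> 0 < eps -> eps <= T%:R / 1024 -> 0 < eta -> eta <= 1 / 4 ->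
       c * (T%:R ^+ 3 * eps ^- 2 * ln (1 / eta)) <= sample_bound T eps eta).
Proof.
split; last first.
  exists (4 * (352 * 1024))^-1 => [|T eps eta _ _ _]; first by lra.
  exact: sample_bound_ge.
move=> T eps eta T8 eps0 epsT eta0 eta2.
have T8R : 8 <= T%:R :> R by rewrite ler_nat.
pose q1 : R := 1 / (2 * T%:R); pose d : R := 16 * eps / T%:R ^+ 2.
have T0 : 0 < T%:R :> R by lra.
have q1T : q1 * T%:R = 1 / 2 by rewrite /q1; field; rewrite gt_eqF.
have q10 : 0 < q1 by rewrite divr_gt0 ?mulr_gt0.
have q1h : q1 <= 1 / 16 by have := ler_wpM2l (ltW q10) T8R; lra.
have d0 : 0 < d by rewrite divr_gt0 ?mulr_gt0 ?exprn_gt0.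
have dT : d * T%:R ^+ 2 = 16 * eps by rewrite /d divfK// gt_eqF// exprn_gt0.
have dq1 : d < q1.
  (* Multiplied by [T ^ 2], the claim is [16 * eps < T / 2]; the hypothesis gives
     [16 * eps <= T / 64]. *)
  rewrite -(ltr_pM2r (exprn_gt0 2 T0)) dT expr2 mulrA q1T; lra.
exists (fun b => unit_inventory T (if b then q1 else q1 - d)).
have qh b : 0 < (if b then q1 else q1 - d) <= 1 / 2.
  by case: b; apply/andP; split; lra.
have qh0 b : 0 <= (if b then q1 else q1 - d) <= 1 / 2.
  by have /andP[/ltW -> ->] := qh b.
have q01 b : 0 <= (if b then q1 else q1 - d) <= 1.
  by have /andP[? ?] := qh b; apply/andP; split; lra.
split=> [/= Deq|b|M e est].
(* The two laws differ in the mass they give to the point 1. *)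
- have : binary_demand (q1 - d) [set 1] = binary_demand q1 [set 1] by rewrite Deq.
  rewrite !binary_demandE ?(q01 false) ?(q01 true)// => -[].
  rewrite !indicE (@memNset _ [set 1] 0); last first.
    by move/esym/eqP; rewrite oner_eq0.
  rewrite (@mem_set _ [set 1] 1)//=.
  by lra.
- split => //; last exact: optimal_base_stock0.
  apply: etrans (binary_demandE _ (q01 b)) _.
  rewrite !indicE !mem_set; [|by right|by left].
  by rewrite !mulr1 subrK.
- apply: sample_bound_le => //.
  apply: (@separated_values_sample_bound R T M (q1 - d) q1 eps eta e) => //.
  + exact: (qh false).
  + exact: (qh true).
  (* Since [d * T ^ 2 = 16 * eps], the gap is at least [49 / 16 * eps], which exceeds [2 * eps]. *)
  + apply: lt_le_trans (base_stock_cost1_gap T8 (ltW d0) (ltW dq1) q1T).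
    by lra.
  + exact: (est false).
  + exact: (est true).
Qed.
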